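(* For each positive integer $m$, let $D_m$ be the graph distance matrix of the comet graph $C_{m^2}^m$, and let $v_m$ be the top eigenvector of $D_m$, normalized to have unit $L^2$ norm. Then $$\lim_{m\to\infty}\frac{\langle v_m,\mathbbm{1}\rangle}{\sqrt{n}}=\frac{1}{\sqrt{2}},$$ where $n=m^2+m$ is the number of vertices of $C_{m^2}^m$.
   Context: The comet graph $C_{m_1}^{m_2}$ is obtained from the disjoint union of the complete graph on $m_1$ vertices and the path graph on $m_2$ vertices by adding an edge between one end of the path and one (arbitrary) vertex of the complete graph. The graph distance matrix of a connected graph with vertices $u_1,\dots,u_n$ has entries $D_{ij}=d(u_i,u_j)$ (shortest-path distance). The top eigenvector of such a matrix is the eigenvector with nonnegative entries corresponding to its largest (Perron–Frobenius) eigenvalue. $\mathbbm{1}$ is the all-ones vector and $\langle\cdot,\cdot\rangle$ the standard inner product on $\mathbb{R}^n$; the $L^2$ norm is the Euclidean norm. *)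

(* Defs.v *)
From mathcomp Require Import all_boot all_order all_algebra.
From mathcomp Require Import all_classical all_reals all_analysis.
Set Implicit Arguments.
Unset Strict Implicit.
Unset Printing Implicit Defensive.
Import Order.TTheory GRing.Theory Num.Theory.
Local Open Scope ring_scope.

Definition complete_graph (n : nat) : rel 'I_n := fun i j => i != j.

Definition path_graph (n : nat) : rel 'I_n :=
  fun i j => (i.+1 == j :> nat) || (j.+1 == i :> nat).

(* The numeral [a] (meaningful when [a < m1]) is the vertex of the complete
   graph to which the end [0] of the path is attached. *)
Definition comet_graph (m1 m2 a : nat) : rel 'I_(m1 + m2) := fun i j =>
  match fintype.split i, fintype.split j with
  | inl x, inl y => complete_graph x y
  | inr x, inr y => path_graph x y
  | inl x, inr y | inr y, inl x => (x == a :> nat) && (y == 0 :> nat)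
  end.
Arguments comet_graph : clear implicits.

(* Least number of edges of a walk from [x] to [y]; the value is [#|T|] when
   there is no such walk. *)
Definition graph_dist (T : finType) (e : rel T) (x y : T) : nat :=
  \big[minn/#|T|]_(k < #|T| |
    [exists p : k.-tuple T, path e x p && (last x p == y)]) k.

Lemma graph_distP (T : finType) (e : rel T) (x y : T) :
  connect e x y ->
  (exists2 p : seq T, path e x p /\ last x p = y & size p = graph_dist e x y) /\
  (forall p : seq T, path e x p -> last x p = y -> (graph_dist e x y <= size p)%N).
Proof.
pose P (k : nat) := [exists p : k.-tuple T, path e x p && (last x p == y)].
have short p : path e x p -> last x p = y ->
    exists2 k : 'I_#|T|, P k & (k <= size p)%N.
  move=> pe ly; case: (shortenP pe) ly => q qe uq sub ly.
  have lt : (size q < #|T|)%N by rewrite -[(size q).+1]/(size (x :: q))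
      -(card_uniqP uq) max_card.
  exists (Ordinal lt); last by apply: uniq_leq_size sub; case/andP: uq.
  by apply/existsP; exists (in_tuple q); rewrite /= qe ly eqxx.
have le (k : 'I_#|T|) : P k -> (graph_dist e x y <= k)%N.
  move=> Pk; rewrite /graph_dist.
  have : k \in index_enum 'I_#|T| by rewrite mem_index_enum.
  elim: (index_enum _) => // h s IH; rewrite inE big_cons => /orP[/eqP<-|ks].
    by rewrite -/(P k) Pk geq_minl.
  by case: ifP => _; [apply: leq_trans (geq_minr _ _) (IH ks) | exact: IH].
move=> /connectP[p pe ly]; split=> [|q qe lq]; last first.
  by have [k Pk kq] := short q qe lq; exact: leq_trans (le k Pk) kq.
have [k Pk _] := short p pe (esym ly).
have : graph_dist e x y = #|T| \/ P (graph_dist e x y).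
  rewrite /graph_dist; apply: (big_ind (fun n => n = #|T| \/ P n)) => [|m n Hm Hn|i Pi]; [by left| |by right].
  by rewrite /minn; case: ifP.
case=> [E|/existsP[q /andP[qe /eqP lq]]].
  by have := le k Pk; rewrite E leqNgt ltn_ord.
by exists q => //; rewrite size_tuple.
Qed.

Definition dist_matrix (R : realType) (n : nat) (e : rel 'I_n) : 'M[R]_n :=
  \matrix_(i, j) (graph_dist e i j)%:R.

Definition dotv (R : realType) (n : nat) (u v : 'rV[R]_n) : R :=
  \sum_i u 0 i * v 0 i.

(* The library norm [`|v|] on row vectors is the sup norm. *)
Definition l2norm (R : realType) (n : nat) (v : 'rV[R]_n) : R :=
  Num.sqrt (dotv v v).

(* Eigenvectors are row vectors, as for the library's [eigenvalue]; this is
   immaterial for distance matrices of undirected graphs, which are symmetric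
   (so that also all their eigenvalues lie in [R]). *)
Definition top_eigenvector (R : realType) (n : nat) (A : 'M[R]_n)
    (v : 'rV[R]_n) : Prop :=
  [/\ v != 0,
      forall i, 0 <= v 0 i
    & exists lambda : R,
        v *m A = lambda *: v /\ forall mu : R, eigenvalue A mu -> mu <= lambda].

(* Main.v *)
Require Import Defs.
From mathcomp Require Import all_boot all_order all_algebra.
From mathcomp Require Import all_classical all_reals all_analysis.
From mathcomp Require Import ring lra.
From mathcomp Require Import zify.
Import Order.TTheory GRing.Theory Num.Theory.
Import numFieldNormedType.Exports.
Local Open Scope classical_set_scope.
Local Open Scope ring_scope.

(** Write the unit top eigenvector as [(u, w)], with [u] on the clique and [w]
    on the path, and let [lambda] be its eigenvalue.  Half of the squared mass
    of the eigenvector sits on each part, but on the clique it is spread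
    evenly over almost all the vertices, whereas the path has too few vertices
    to contribute to the sum of the entries.

    The reason for the equal split is that the clique-path block [C] of the
    distance matrix dominates.  Pairing the two block rows of the eigenvalue
    equation with [u] and [w] and subtracting, the contributions of [C] cancel
    ([block_eigen_balance]):
      [lambda * (|u|^2 - |w|^2) = u (J - I) u^T - w P w^T],
    where [J - I] and [P] are the clique-clique and path-path blocks.  For the
    clique of size [m^2] and the path of size [m], both quadratic forms are
    [O(m^2)], because the entries of [J - I] are at most 1 and those of [P] at
    most [2 m].  The eigenvalue is much larger: [C] is bounded below entrywise
    by the rank one matrix whose rows [j] are constant equal to [j + 1], hence
    [lambda ^ 2 >= m^2 * (1^2 + ... + m^2) >= m^5 / 3] ([block_eigen_lower]).
    It follows that [(2 |u|^2 - 1)^2 = O(1 / m)], so that [|u|^2] tends to 1/2.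

    All clique vertices but the attaching one are equally far from the path,
    and the attaching one is closer, so the entries of [u] are equal and
    maximal there; this makes Cauchy-Schwarz almost an equality,
      [(m^2 - 1) |u|^2 <= (sum of u)^2 <= m^2 |u|^2]
    ([clique_almost_constant]).  Finally the sum of [w] is at most [sqrt m].
    Dividing by [sqrt (m^2 + m)] and letting [m] go to infinity gives
    [1 / sqrt 2]. *)

(** * Shortest-path distance in finite graphs *)

Lemma graph_dist_le (T : finType) (e : rel T) (x : T) (p : seq T) :
  path e x p -> (graph_dist e x (last x p) <= size p)%N.
Proof.
move=> ep; have /graph_distP[_] : connect e x (last x p) by apply/connectP; exists p.
exact.
Qed.

Lemma graph_dist_edge (T : finType) (e : rel T) (x y : T) :
  e x y -> (graph_dist e x y <= 1)%N.
Proof. by move=> exy; apply: (graph_dist_le _ e x [:: y]); rewrite /= exy. Qed.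

Lemma graph_dist_triangle (T : finType) (e : rel T) (x y z : T) :
  connect e x y -> connect e y z ->
  (graph_dist e x z <= graph_dist e x y + graph_dist e y z)%N.
Proof.
move=> /graph_distP[[p [ep lp] <-] _] /graph_distP[[q [eq lq] <-] _].
have -> : z = last x (p ++ q) by rewrite last_cat lp.
by rewrite -size_cat graph_dist_le // cat_path ep lp.
Qed.

Lemma graph_dist_sym_le (T : finType) (e : rel T) (x y : T) :
  symmetric e -> connect e x y -> (graph_dist e y x <= graph_dist e x y)%N.
Proof.
move=> esym /graph_distP[[p [ep lp] <-] _].
have er : path e y (rev (belast x p)).
  by rewrite -lp rev_path (eq_path (e' := e)).
have -> : x = last y (rev (belast x p)).
  by case: p lp {ep er} => [|z p] //= _; rewrite rev_cons last_rcons.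
by apply: leq_trans (graph_dist_le _ _ _ _ er) _; rewrite size_rev size_belast.
Qed.

Lemma graph_distC (T : finType) (e : rel T) (x y : T) :
  symmetric e -> connect e x y -> graph_dist e x y = graph_dist e y x.
Proof.
move=> esym cxy; apply/eqP; rewrite eqn_leq !graph_dist_sym_le //.
by rewrite -(sym_connect_sym esym).
Qed.

Lemma graph_dist_lipschitz (T : finType) (e : rel T) (f : T -> nat) (x y : T) :
  (forall s t, e s t -> (f t <= (f s).+1)%N) -> connect e x y ->
  (f y <= f x + graph_dist e x y)%N.
Proof.
move=> lip /graph_distP[[p [+ <-] <-] _]; elim: p x => [|z p IH] x /=.
  by rewrite addn0.
by case/andP=> /lip exz /IH; lia.
Qed.

Lemma graph_dist_refl (T : finType) (e : rel T) (x : T) : graph_dist e x x = 0%N.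
Proof. by apply/eqP; rewrite -leqn0 (graph_dist_le _ e x [::]). Qed.

Lemma graph_dist_eq0 (T : finType) (e : rel T) (x y : T) :
  connect e x y -> (graph_dist e x y == 0)%N = (x == y).
Proof.
move=> cxy; apply/idP/eqP => [/eqP d0|->]; last by rewrite graph_dist_refl.
have [[p [_ lp] +] _] := graph_distP cxy.
by rewrite d0 => /size0nil p0; rewrite -lp p0.
Qed.

(** * Distances in the comet graph *)

Lemma comet_ll (m1 m2 a : nat) (x y : 'I_m1) :
  comet_graph m1 m2 a (lshift m2 x) (lshift m2 y) = (x != y).
Proof.
by rewrite /comet_graph (unsplitK (inl _ x)) (unsplitK (inl _ y)).
Qed.

Lemma comet_lr (m1 m2 a : nat) (x : 'I_m1) (i : 'I_m2) :
  comet_graph m1 m2 a (lshift m2 x) (rshift m1 i)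
  = (x == a :> nat) && (i == 0 :> nat).
Proof.
by rewrite /comet_graph (unsplitK (inl _ x)) (unsplitK (inr _ i)).
Qed.

Lemma comet_rr (m1 m2 a : nat) (i j : 'I_m2) :
  comet_graph m1 m2 a (rshift m1 i) (rshift m1 j)
  = (i.+1 == j :> nat) || (j.+1 == i :> nat).
Proof.
by rewrite /comet_graph (unsplitK (inr _ i)) (unsplitK (inr _ j)).
Qed.

Lemma comet_sym (m1 m2 a : nat) : symmetric (comet_graph m1 m2 a).
Proof.
move=> x y; rewrite /comet_graph.
case: (fintype.split x) => i; case: (fintype.split y) => j //.
  by rewrite /complete_graph eq_sym.
by rewrite /path_graph orbC.
Qed.

(** The path vertex [i] is reached from the attaching vertex by walking along
    the path, hence [i + 1] steps. *)
Lemma comet_dist_attach (m1 m2 : nat) (a : 'I_m1) (i : 'I_m2) :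
  connect (comet_graph m1 m2 a) (lshift m2 a) (rshift m1 i) /\
  (graph_dist (comet_graph m1 m2 a) (lshift m2 a) (rshift m1 i) <= i.+1)%N.
Proof.
set e := comet_graph m1 m2 a.
case: i => i; elim: i => [|i IH] lti.
  have ea : e (lshift m2 a) (rshift m1 (Ordinal lti)) by rewrite /e comet_lr !eqxx.
  by split; [exact: connect1|exact: graph_dist_edge].
have [ci di] := IH (ltnW lti).
have ei : e (rshift m1 (Ordinal (ltnW lti))) (rshift m1 (Ordinal lti)).
  by rewrite /e comet_rr /= eqxx.
split; first exact: connect_trans ci (connect1 ei).
apply: leq_trans (graph_dist_triangle _ _ _ _ _ ci (connect1 ei)) _.
by have := graph_dist_edge _ _ _ _ ei; rewrite /= in di *; lia.
Qed.

Lemma comet_connect_attach (m1 m2 : nat) (a : 'I_m1) (z : 'I_(m1 + m2)) :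
  connect (comet_graph m1 m2 a) (lshift m2 a) z.
Proof.
case: (split_ordP z) => [x ->|i ->]; last by case: (comet_dist_attach m1 m2 a i).
have [->//|nax] := eqVneq a x; by apply: connect1; rewrite comet_ll.
Qed.

Lemma comet_connect (m1 m2 : nat) (a : 'I_m1) (y z : 'I_(m1 + m2)) :
  connect (comet_graph m1 m2 a) y z.
Proof.
apply: connect_trans (comet_connect_attach m1 m2 a z).
rewrite (sym_connect_sym (comet_sym m1 m2 a)).
exact: comet_connect_attach.
Qed.

Lemma comet_dist_clique (m1 m2 : nat) (a x y : 'I_m1) :
  graph_dist (comet_graph m1 m2 a) (lshift m2 x) (lshift m2 y) = (x != y).
Proof.
have [->|nxy] := eqVneq x y; first by rewrite graph_dist_refl.
apply/eqP; rewrite eqn_leq graph_dist_edge ?comet_ll //= lt0n.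
by rewrite graph_dist_eq0 ?comet_connect // (inj_eq (@lshift_inj _ _)).
Qed.

(** The lower bound comes from the height function that is 0 on the clique,
    except for 1 at the attaching vertex, and [i + 2] at path vertex [i]:
    it changes by at most 1 along every edge. *)
Lemma comet_dist_clique_path (m1 m2 : nat) (a x : 'I_m1) (i : 'I_m2) :
  graph_dist (comet_graph m1 m2 a) (lshift m2 x) (rshift m1 i)
  = (i.+1 + (x != a))%N.
Proof.
set e := comet_graph m1 m2 a.
pose f (z : 'I_(m1 + m2)) : nat :=
  match fintype.split z with inl y => (y == a) | inr j => j.+2 end.
have fl y : f (lshift m2 y) = (y == a) by rewrite /f (unsplitK (inl _ y)).
have fr j : f (rshift m1 j) = j.+2 by rewrite /f (unsplitK (inr _ j)).
have lip s t : e s t -> (f t <= (f s).+1)%N.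
  case: (split_ordP s) => [y ->|j ->]; case: (split_ordP t) => [z ->|k ->];
    rewrite ?fl ?fr.
  - by case: (z == a).
  - by rewrite /e comet_lr => /andP[/eqP/val_inj -> /eqP ->]; rewrite eqxx.
  - by case: (z == a).
  - by rewrite /e comet_rr; lia.
have := graph_dist_lipschitz _ e f _ _ lip (comet_connect m1 m2 a (lshift m2 x) (rshift m1 i)).
rewrite fl fr => lower.
have := graph_dist_triangle _ e (lshift m2 x) (lshift m2 a) (rshift m1 i)
  (comet_connect _ _ _ _ _) (comet_connect _ _ _ _ _).
rewrite /e comet_dist_clique -/e => upper.
have [_ da] := comet_dist_attach m1 m2 a i.
by move: lower upper da; rewrite -/e; case: (x == a) => /=; lia.
Qed.

Lemma comet_dist_path_clique (m1 m2 : nat) (a x : 'I_m1) (i : 'I_m2) :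
  graph_dist (comet_graph m1 m2 a) (rshift m1 i) (lshift m2 x)
  = (i.+1 + (x != a))%N.
Proof.
rewrite graph_distC ?comet_connect //; first exact: comet_dist_clique_path.
exact: comet_sym.
Qed.

(** A detour through the attaching vertex; the resulting bound is within a
    constant factor of the largest distance, and the path-path block of the
    distance matrix is of lower order anyway. *)
Lemma comet_dist_path_le (m1 m2 : nat) (a : 'I_m1) (i j : 'I_m2) :
  (graph_dist (comet_graph m1 m2 a) (rshift m1 i) (rshift m1 j) <= 2 * m2)%N.
Proof.
have := graph_dist_triangle _ (comet_graph m1 m2 a) (rshift m1 i) (lshift m2 a) (rshift m1 j)
  (comet_connect _ _ _ _ _) (comet_connect _ _ _ _ _).
rewrite comet_dist_path_clique comet_dist_clique_path eqxx.
have := ltn_ord i; have := ltn_ord j; lia.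
Qed.

(** * Inequalities for eigenvectors of nonnegative block matrices *)

(** Cauchy-Schwarz against the constant vector; the defect is half of the sum
    of the squares of all the differences [f i - f j]. *)
Lemma sqr_sum_le (R : realFieldType) (I : finType) (f : I -> R) :
  (\sum_i f i) ^+ 2 <= #|I|%:R * \sum_i f i ^+ 2.
Proof.
have : 0 <= \sum_i \sum_j (f i - f j) ^+ 2.
  by apply: sumr_ge0 => i _; apply: sumr_ge0 => j _; exact: sqr_ge0.
have inner i : \sum_j (f i - f j) ^+ 2
    = #|I|%:R * f i ^+ 2 + \sum_j f j ^+ 2 - 2 * (\sum_j f j) * f i.
  rewrite (eq_bigr (fun j => f i ^+ 2 + f j ^+ 2 - 2 * f i * f j)); last first.
    by move=> j _; ring.
  rewrite sumrB big_split /= sumr_const -mulr_sumr -mulr_natl; ring.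
under eq_bigr do rewrite inner.
rewrite sumrB big_split /= sumr_const -!mulr_sumr -[_ *+ #|I|]mulr_natl.
nra.
Qed.

Lemma quad_form_bound (R : realFieldType) (I : finType) (c : R) (u : I -> R)
    (A : I -> I -> R) :
  (forall x, 0 <= u x) -> (forall x y, 0 <= A x y <= c) ->
  0 <= \sum_x u x * \sum_y u y * A y x <= c * (\sum_x u x) ^+ 2.
Proof.
move=> u0 Ac; apply/andP; split.
  apply: sumr_ge0 => x _; rewrite mulr_ge0 // sumr_ge0 // => y _.
  by rewrite mulr_ge0 //; case/andP: (Ac y x).
have -> : c * (\sum_x u x) ^+ 2 = \sum_x u x * \sum_y u y * c.
  by rewrite -mulr_suml -mulr_suml; ring.
apply: ler_sum => x _; apply: ler_wpM2l => //.
by apply: ler_sum => y _; rewrite ler_wpM2l //; case/andP: (Ac y x).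
Qed.

(** Pair the two block equations with [u] and [w] and subtract: the same
    off-diagonal term appears in both and cancels.  Hence a large eigenvalue
    forces [u] and [w] to have almost the same norm, however large [C] is. *)
Lemma block_eigen_balance (R : realFieldType) (I J : finType) (lambda : R)
    (u : I -> R) (w : J -> R) (A : I -> I -> R) (B : J -> J -> R)
    (C : J -> I -> R) :
  (forall x, lambda * u x = \sum_y u y * A y x + \sum_i w i * C i x) ->
  (forall j, lambda * w j = \sum_x u x * C j x + \sum_i w i * B i j) ->
  lambda * (\sum_x u x ^+ 2 - \sum_j w j ^+ 2)
  = \sum_x u x * (\sum_y u y * A y x) - \sum_j w j * (\sum_i w i * B i j).
Proof.
move=> Eu Ew.
have -> : lambda * (\sum_x u x ^+ 2 - \sum_j w j ^+ 2)
    = \sum_x u x * (lambda * u x) - \sum_j w j * (lambda * w j).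
  rewrite mulrBr !mulr_sumr.
  by congr (_ - _); apply: eq_bigr => i _; ring.
under eq_bigr do rewrite Eu mulrDr.
under [X in _ - X]eq_bigr do rewrite Ew mulrDr.
rewrite !big_split /=.
suff -> : \sum_x u x * (\sum_i w i * C i x) = \sum_j w j * (\sum_x u x * C j x).
  by ring.
under eq_bigr do rewrite mulr_sumr.
rewrite exchange_big /=; apply: eq_bigr => j _; rewrite mulr_sumr.
by apply: eq_bigr => x _; ring.
Qed.

(** With [S] the sum of [u] and [T] the sum of [h * w], dropping the diagonal
    blocks and replacing [C] by its minorant gives [#|I| * T <= lambda * S] and
    [S * |h|^2 <= lambda * T]; multiply and cancel [S], which cannot vanish
    because otherwise [T], then [w] and [u], would vanish too. *)
Lemma block_eigen_lower (R : realFieldType) (I J : finType) (lambda : R)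
    (u : I -> R) (w : J -> R) (A : I -> I -> R) (B : J -> J -> R)
    (C : J -> I -> R) (h : J -> R) :
  (0 < #|I|)%N ->
  (forall x, 0 <= u x) -> (forall j, 0 <= w j) ->
  0 < \sum_x u x ^+ 2 + \sum_j w j ^+ 2 ->
  (forall x y, 0 <= A x y) -> (forall i j, 0 <= B i j) ->
  (forall j, 0 < h j) -> (forall j x, h j <= C j x) ->
  (forall x, lambda * u x = \sum_y u y * A y x + \sum_i w i * C i x) ->
  (forall j, lambda * w j = \sum_x u x * C j x + \sum_i w i * B i j) ->
  0 <= lambda /\ #|I|%:R * \sum_j h j ^+ 2 <= lambda ^+ 2.
Proof.
move=> I0 u0 w0 nz A0 B0 h0 hC Eu Ew.
set S := \sum_x u x; set T := \sum_j h j * w j.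
have S0 : 0 <= S by exact: sumr_ge0.
have hw j : 0 <= h j * w j by rewrite mulr_ge0 // ltW.
have T0 : 0 <= T by apply: sumr_ge0.
have lamS : #|I|%:R * T <= lambda * S.
  rewrite [leRHS]mulr_sumr mulr_natl -sumr_const; apply: ler_sum => x _.
  rewrite Eu -[leLHS]add0r lerD //.
    by apply: sumr_ge0 => y _; rewrite mulr_ge0.
  by apply: ler_sum => j _; rewrite mulrC ler_wpM2l.
have lamT : S * \sum_j h j ^+ 2 <= lambda * T.
  rewrite !mulr_sumr; apply: ler_sum => j _.
  rewrite [leRHS]mulrCA Ew expr2 [leLHS]mulrCA ler_wpM2l ?(ltW (h0 _)) //.
    rewrite -[X in X <= _]addr0 lerD //.
    by rewrite mulr_suml; apply: ler_sum => x _; rewrite ler_wpM2l.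
  by apply: sumr_ge0 => y _; rewrite mulr_ge0.
have I0' : 0 < #|I|%:R :> R by rewrite ltr0n.
have Spos : 0 < S.
  rewrite lt_neqAle S0 andbT eq_sym; apply/eqP => SE.
  have /eqP : T = 0.
    apply/eqP; rewrite eq_le T0 andbT -(pmulr_rle0 _ I0').
    by apply: le_trans lamS _; rewrite SE mulr0.
  rewrite psumr_eq0 // => /allP wz.
  move/eqP: SE; rewrite psumr_eq0 // => /allP uz.
  move: nz; rewrite !big1 ?addr0 ?ltxx // => i _.
    have := wz i; rewrite mem_index_enum => /(_ isT) /=.
    by rewrite mulf_eq0 gt_eqF //= => /eqP ->; rewrite expr0n.
  by have := uz i; rewrite mem_index_enum => /(_ isT) /eqP ->; rewrite expr0n.
have lam0 : 0 <= lambda.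
  by rewrite -(pmulr_lge0 _ Spos); apply: le_trans lamS; rewrite mulr_ge0 // ltW.
split=> //; rewrite -(ler_pM2r Spos).
have -> : lambda ^+ 2 * S = lambda * (lambda * S) by ring.
apply: le_trans (ler_wpM2l lam0 lamS).
have -> : lambda * (#|I|%:R * T) = #|I|%:R * (lambda * T) by ring.
by rewrite -mulrA [_ * S]mulrC ler_wpM2l // ltW.
Qed.

(** Adding [u x] to the equation at [x] makes the clique contribution the same
    at every vertex, so [(lambda + 1) * u x] depends on [x] through its
    distances to the path only; these are maximal at every [y != a].  So every
    entry of [u] is at most the average of the entries away from [a]. *)
Lemma clique_almost_constant (R : realFieldType) (I J : finType) (lambda : R)
    (a : I) (u : I -> R) (w : J -> R) (C : J -> I -> R) :
  0 <= lambda -> (forall x, 0 <= u x) -> (forall j, 0 <= w j) ->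
  (forall j x y, y != a -> C j x <= C j y) ->
  (forall x, lambda * u x = \sum_y u y * (y != x)%:R + \sum_i w i * C i x) ->
  (#|I|%:R - 1) * \sum_x u x ^+ 2 <= (\sum_x u x) ^+ 2.
Proof.
move=> lam0 u0 w0 Cmax Eu.
have Eu' x : (lambda + 1) * u x = \sum_y u y + \sum_i w i * C i x.
  rewrite mulrDl Eu mul1r addrAC; congr (_ + _).
  rewrite [RHS](bigD1 x) //= addrC; congr (_ + _).
  rewrite (bigD1 x) //= eqxx mulr0 add0r.
  by apply: eq_bigr => y ->; rewrite mulr1.
have mono x y : y != a -> u x <= u y.
  move=> ya; rewrite -(ler_pM2l (_ : 0 < lambda + 1)) ?ltr_wpDl //.
  rewrite !Eu' lerD2l; apply: ler_sum => j _.
  by rewrite ler_wpM2l // Cmax.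
have bound x : (#|I|%:R - 1) * u x <= \sum_y u y.
  rewrite mulrBl mul1r mulr_natl -sumr_const (bigD1 a) //= [leRHS](bigD1 a) //=.
  have : \sum_(i | i != a) u x <= \sum_(i | i != a) u i.
    by apply: ler_sum => y ya; exact: mono.
  by have := u0 a; lra.
rewrite expr2 mulr_sumr mulr_suml; apply: ler_sum => x _.
by rewrite expr2 mulrCA ler_wpM2l.
Qed.

Lemma sum_sqr_lower (R : realFieldType) (m : nat) :
  m%:R ^+ 3 <= 3 * \sum_(j < m) j.+1%:R ^+ 2 :> R.
Proof.
elim: m => [|m IH]; first by rewrite big_ord0 mulr0 expr0n.
rewrite big_ord_recr /= mulrDr; apply: le_trans (lerD IH (lexx _)).
by rewrite -natr1; have : 0 <= m%:R :> R by []; nra.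
Qed.

(** * Estimates for the top eigenvector of a comet *)

(** [S] and [W] are the sums of the entries over the clique and over the path,
    and [U] is the squared norm of the clique part.  The last estimate is the
    square of [lambda * (2 * U - 1) = O(m1 + m2 ^ 2)] combined with
    [m1 * m2 ^ 3 <= 3 * lambda ^ 2]. *)
Lemma comet_eigen_estimates (R : realType) (m1 m2 : nat) (a : 'I_m1)
    (v : 'rV[R]_(m1 + m2)) :
  top_eigenvector (dist_matrix R (comet_graph m1 m2 a)) v -> l2norm v = 1 ->
  exists S W U : R,
    [/\ dotv v (const_mx 1) = S + W,
        0 <= S /\ (m1%:R - 1) * U <= S ^+ 2 <= m1%:R * U,
        0 <= W /\ W ^+ 2 <= m2%:R
      & m1%:R * m2%:R ^+ 3 * (2 * U - 1) ^+ 2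
          <= 3 * (m1%:R + 2 * m2%:R ^+ 2) ^+ 2].
Proof.
move=> [_ v0 [lambda [ev _]]] v1.
pose u (x : 'I_m1) : R := v 0 (lshift m2 x); pose w (i : 'I_m2) : R := v 0 (rshift m1 i).
have u0 x : 0 <= u x by exact: v0.
have w0 i : 0 <= w i by exact: v0.
pose C (i : 'I_m2) (x : 'I_m1) : R := (i.+1 + (x != a))%:R.
pose B (i j : 'I_m2) : R :=
  (graph_dist (comet_graph m1 m2 a) (rshift m1 i) (rshift m1 j))%:R.
have Eu x : lambda * u x = \sum_y u y * (y != x)%:R + \sum_i w i * C i x.
  have /(congr1 (fun z : 'rV_ _ => z 0 (lshift m2 x))) := ev.
  rewrite !mxE => <-; rewrite big_split_ord /=; congr (_ + _);
    apply: eq_bigr => z _; rewrite mxE.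
    by rewrite comet_dist_clique.
  by rewrite comet_dist_path_clique.
have Ew j : lambda * w j = \sum_x u x * C j x + \sum_i w i * B i j.
  have /(congr1 (fun z : 'rV_ _ => z 0 (rshift m1 j))) := ev.
  rewrite !mxE => <-; rewrite big_split_ord /=; congr (_ + _);
    apply: eq_bigr => z _; rewrite mxE //.
  by rewrite comet_dist_clique_path.
set U := \sum_x u x ^+ 2; set V := \sum_i w i ^+ 2.
have V0 : 0 <= V by apply: sumr_ge0 => i _; exact: sqr_ge0.
have U0 : 0 <= U by apply: sumr_ge0 => i _; exact: sqr_ge0.
have UV : U + V = 1.
  have vvE : dotv v v = U + V.
    by rewrite /dotv big_split_ord.
  by rewrite -vvE -[LHS]sqr_sqrtr ?[Num.sqrt _]v1 ?expr1n // vvE addr_ge0.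
have Bb i j : 0 <= B i j <= 2 * m2%:R.
  by rewrite ler0n -natrM ler_nat comet_dist_path_le.
have Ab (x y : 'I_m1) : 0 <= ((x != y)%:R : R) <= 1 by case: (x != y); rewrite /= ?lexx ler01.
have I0 : (0 < #|'I_m1|)%N by rewrite card_ord (leq_ltn_trans _ (ltn_ord a)).
have [lam0 lamL] : 0 <= lambda /\
    #|'I_m1|%:R * \sum_(j < m2) j.+1%:R ^+ 2 <= lambda ^+ 2.
  apply: (block_eigen_lower _ _ _ lambda u w (fun x y => (x != y)%:R) B C) => //.
  - by rewrite -/U -/V UV.
  - by move=> j x; rewrite ler_nat leq_addr.
have bal := block_eigen_balance _ _ _ _ _ _ _ _ _ Eu Ew.
have /andP[A0 A1] := quad_form_bound _ _ 1 u (fun y x => (y != x)%:R) u0 Ab.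
have /andP[B0 B1] := quad_form_bound _ _ _ w B w0 Bb.
have near_const := clique_almost_constant _ _ _ lambda a u w C lam0 u0 w0.
exists (\sum_x u x), (\sum_i w i), U.
have SU := sqr_sum_le _ _ u; have WV := sqr_sum_le _ _ w.
rewrite !card_ord -/U -/V in lamL near_const SU WV *.
have m10 : 0 <= m1%:R :> R by []. have m20 : 0 <= m2%:R :> R by [].
have W2 : (\sum_i w i) ^+ 2 <= m2%:R by apply: le_trans WV _; nra.
split; [|split|split|].
- by rewrite /dotv big_split_ord /=; congr (_ + _); apply: eq_bigr => i _;
    rewrite mxE mulr1.
- exact: sumr_ge0.
- rewrite SU andbT; apply: near_const => // j x y ya.
  by rewrite ler_nat ya leq_add2l leq_b1.
- exact: sumr_ge0.
- exact: W2.
have mQ := sum_sqr_lower R m2.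
have bal' : lambda * (2 * U - 1) = lambda * (U - V)
  by congr (_ * _); lra.
rewrite bal in bal'.
set X := \sum_x u x * _ in A0 A1 bal'; set Y := \sum_i w i * _ in B0 B1 bal'.
have sq : (lambda * (2 * U - 1)) ^+ 2 <= (m1%:R + 2 * m2%:R ^+ 2) ^+ 2.
  rewrite bal' -[leLHS]real_normK ?num_real // ler_sqr ?nnegrE //.
  have XS : X <= m1%:R.
    have : m1%:R * U <= m1%:R by rewrite ler_piMr //; lra.
    lra.
  have YW : Y <= 2 * m2%:R ^+ 2.
    apply: le_trans B1 _; rewrite -mulrA ler_pM2l ?ltr0n // expr2.
    exact: ler_wpM2l.
  by rewrite ler_norml; apply/andP; split; lra.
rewrite exprMn in sq.
apply: le_trans (_ : 3 * (lambda ^+ 2 * (2 * U - 1) ^+ 2) <= _); last by lra.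
rewrite mulrA ler_wpM2r ?sqr_ge0 //.
apply: le_trans (_ : m1%:R * (3 * \sum_(j < m2) j.+1%:R ^+ 2) <= _); last by lra.
by rewrite ler_wpM2l.
Qed.

(** * Passage to the limit *)

Lemma cvg_sqrt (R : realType) (f : nat -> R) (l : R) :
  f @ \oo --> l -> (fun m => Num.sqrt (f m)) @ \oo --> Num.sqrt l.
Proof. by move=> fl; apply: (cvg_comp f _ fl); exact: sqrt_continuous. Qed.

Lemma cvg_sqrt_harmonic (R : realType) (c : R) :
  (fun m => Num.sqrt (c * harmonic m)) @ \oo --> (0 : R).
Proof.
rewrite -(sqrtr0 R); apply: cvg_sqrt.
rewrite -[X in _ --> X](mulr0 c).
by apply: cvgM; [exact: cvg_cst|exact: cvg_harmonic].
Qed.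

Theorem theorem10 (R : realType) (a : nat -> nat)
    (v : forall m : nat, 'rV[R]_(m ^ 2 + m)) :
  (forall m : nat, (0 < m)%N -> (a m < m ^ 2)%N) ->
  (forall m : nat, (0 < m)%N ->
     top_eigenvector (dist_matrix R (comet_graph (m ^ 2) m (a m))) (v m) /\
     l2norm (v m) = 1) ->
  (fun m : nat => dotv (v m) (const_mx 1) / Num.sqrt (m ^ 2 + m)%:R)
    @ \oo --> (1 / Num.sqrt 2 : R).
Proof.
(* Shifting the index by one discards [m = 0], where nothing is assumed. *)
move=> am Hv; rewrite -cvg_shiftS /=.
pose k (m : nat) : R := m.+1%:R.
have k0 m : 0 < k m by rewrite ltr0n.
have hE m : harmonic m = (k m)^-1 by [].
have kh m : k m * harmonic m = 1 by rewrite hE divff // gt_eqF.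
have nE m : (m.+1 ^ 2 + m.+1)%:R = k m ^+ 2 + k m by rewrite natrD natrX.
have n0 m : 0 < k m ^+ 2 + k m by rewrite addr_gt0 // exprn_gt0.
have est m : exists p : R * R * R,
    [/\ dotv (v m.+1) (const_mx 1) = p.1.1 + p.1.2,
        0 <= p.1.1 /\ (k m ^+ 2 - 1) * p.2 <= p.1.1 ^+ 2 <= k m ^+ 2 * p.2,
        0 <= p.1.2 /\ p.1.2 ^+ 2 <= k m
      & k m * (2 * p.2 - 1) ^+ 2 <= 27].
  have [tv nv] := Hv m.+1 isT.
  have [S [W [U [dE HS HW HU]]]] :=
    comet_eigen_estimates R _ _ (Ordinal (am m.+1 isT)) _ tv nv.
  exists (S, W, U); rewrite natrX in HS HU; split=> //=.
  have k4 : 0 < k m ^+ 4 by rewrite exprn_gt0.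
  rewrite -(ler_pM2l k4).
  have -> : k m ^+ 4 * (k m * (2 * U - 1) ^+ 2)
      = k m ^+ 2 * k m ^+ 3 * (2 * U - 1) ^+ 2 by ring.
  apply: le_trans HU _; rewrite -/(k m); lra.
have [p Hp] := choice est.
pose S m := (p m).1.1; pose W m := (p m).1.2; pose U m := (p m).2.
(* The estimate reads [|2 U - 1| <= sqrt (27 / k)]. *)
have cvgU : U @ \oo --> (2^-1 : R).
  pose e (m : nat) : R := Num.sqrt (27 * harmonic m).
  have e0 : e @ \oo --> (0 : R) by exact: cvg_sqrt_harmonic.
  apply: (@squeeze_cvgr _ _ _ _ (fun m => 2^-1 - e m) (fun m => 2^-1 + e m)).
  - apply: nearW => m; have [_ _ _ Um] := Hp m.
    have : `|2 * U m - 1| <= e m.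
      rewrite -sqrtr_sqr ler_wsqrtr // -(ler_pM2l (k0 m)).
      by rewrite [leRHS]mulrCA kh mulr1.
    have : 0 <= e m by exact: sqrtr_ge0.
    rewrite ler_norml => ? /andP[]; lra.
  - by rewrite -[X in _ --> X]subr0; apply: cvgB => //; exact: cvg_cst.
  - by rewrite -[X in _ --> X]addr0; apply: cvgD => //; exact: cvg_cst.
(* Lower bound: [(k^2 - 1) / (k^2 + k) = 1 - 1 / k]. *)
have cvgS2 : (fun m => S m ^+ 2 / (k m ^+ 2 + k m)) @ \oo --> (2^-1 : R).
  apply: (@squeeze_cvgr _ _ _ _ (fun m => (1 - harmonic m) * U m) U) => //.
  - apply: nearW => m; have [_ [_ /andP[Sl Sr]] _ _] := Hp m.
    rewrite ler_pdivlMr // ler_pdivrMr //; apply/andP; split.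
      apply: le_trans Sl.
      have -> : (1 - harmonic m) * U m * (k m ^+ 2 + k m)
        = (k m ^+ 2 + k m - (k m * harmonic m) * (k m + 1)) * U m by ring.
      by rewrite kh -/(U m); lra.
    have k2 : 0 < k m ^+ 2 by rewrite exprn_gt0.
    have U0 : 0 <= (p m).2 by rewrite -(pmulr_rge0 _ k2) (le_trans (sqr_ge0 _) Sr).
    by apply: le_trans Sr _; rewrite mulrC ler_wpM2l // lerDl ltW.
  - rewrite -[X in _ --> X]mul1r -[X in X * _]subr0.
    by apply: cvgM => //; apply: cvgB; [exact: cvg_cst|exact: cvg_harmonic].
have cvgS : (fun m => S m / Num.sqrt (k m ^+ 2 + k m)) @ \oo --> (1 / Num.sqrt 2 : R).
  rewrite div1r -sqrtrV //.
  have -> : (fun m => S m / Num.sqrt (k m ^+ 2 + k m))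
      = (fun m => Num.sqrt (S m ^+ 2 / (k m ^+ 2 + k m))).
    apply/funext => m; have [_ [Sm _] _ _] := Hp m.
    by rewrite sqrtrM ?sqr_ge0 // sqrtr_sqr ger0_norm // sqrtrV // ltW.
  exact: cvg_sqrt cvgS2.
(* [W^2 / (k^2 + k) <= k / k^2]. *)
have cvgW : (fun m => W m / Num.sqrt (k m ^+ 2 + k m)) @ \oo --> (0 : R).
  apply: (@squeeze_cvgr _ _ _ _ (fun=> 0) (fun m => Num.sqrt (1 * harmonic m))).
  - apply: nearW => m; have [_ _ [Wm Wk] _] := Hp m.
    rewrite divr_ge0 ?sqrtr_ge0 //=.
    rewrite -[W m]ger0_norm // -sqrtr_sqr -sqrtrV ?(ltW (n0 m)) //.
    rewrite -sqrtrM ?sqr_ge0 // ler_wsqrtr // ler_pdivrMr // mul1r.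
    apply: le_trans Wk _.
    have -> : harmonic m * (k m ^+ 2 + k m) = (k m * harmonic m) * (k m + 1) by ring.
    by rewrite kh; lra.
  - exact: cvg_cst.
  - exact: cvg_sqrt_harmonic.
have -> : (fun m => dotv (v m.+1) (const_mx 1) / Num.sqrt (m.+1 ^ 2 + m.+1)%:R)
    = (fun m => S m / Num.sqrt (k m ^+ 2 + k m) + W m / Num.sqrt (k m ^+ 2 + k m)).
  by apply/funext => m; have [-> _ _ _] := Hp m; rewrite nE mulrDl.
have := cvgD cvgS cvgW; rewrite addr0; exact.
Qed.
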